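(* Let $\mathbb{P}$ be a logic program, let $G=[A_1,\dots,A_k]\in\mathcal{L}At(n)$ be a goal and let $\theta$ be a substitution with source $n$. The following are equivalent. 1. The saturated $\vee$-tree for $G$ in $\mathbb{P}$ has a refutation subtree with answer $\theta$. 2. There is an SLD-refutation for $G$ in $\mathbb{P}$ with correct answer $\theta$.
   Context: Fix a signature $\Sigma$ and predicate symbols with arities. Substitutions: an arrow $\theta:n\to m$ ($n,m$ natural numbers) is an $n$-tuple of $\Sigma$-terms with variables among $x_1,\dots,x_m$; $id_n=\langle x_1,\dots,x_n\rangle$; $\sigma\circ\theta$ is obtained by applying $\sigma$ to the terms of $\theta$. These form a category $\mathbf{L}=\mathbf{L}_\Sigma^{op}$ (opposite Lawvere theory). $At(n)$ is the set of atoms with variables among $x_1,\dots,x_n$; for $\theta:n\to m$ and $A\in At(n)$, $A\theta\in At(m)$ is the result of substituting. $\mathcal{L}At(n)$ is the set of finite lists over $At(n)$. A logic program is a finite set of clauses $H\leftarrow B_1,\dots,B_j$ ($j\ge0$); a clause $C$ has its variables among $x_1,\dots,x_{n_C}$, $n_C$ least. A unifier of $A'\in At(n')$ and the head $H$ of $C$ is a pair $\langle\sigma,\tau\rangle$, $\sigma:n'\to m'$, $\tau:n_C\to m'$, with $A'\sigma=H\tau$ (goal and clause variables are treated as disjoint); it is most general if it is a pushout in $\mathbf{L}$ of the argument tuples of $A'$ and $H$ (viewed as arrows $r\to n'$ and $r\to n_C$, $r$ the arity of the common predicate). Saturated $\vee$-tree for $l\in\mathcal{L}At(n)$ in $\mathbb{P}$: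 the possibly infinite tree whose nodes are labeled with lists of atoms, each in $\mathcal{L}At(m)$ for some $m$, whose root is labeled $l$, and whose edges are labeled with substitutions (an edge from a node with label in $\mathcal{L}At(m)$ to a child with label in $\mathcal{L}At(z)$ is labeled by some $\sigma:m\to z$), such that for every node $s$ with label $[A_1,\dots,A_k]\in\mathcal{L}At(m)$: for all substitutions $\sigma,\tau_1,\dots,\tau_k$ and lists $[C_1,\dots,C_k]$ of clauses of $\mathbb{P}$ such that, for each $C_i=H^i\leftarrow B^i_1,\dots,B^i_{j_i}$, $\langle\sigma,\tau_i\rangle$ is a unifier of $A_i$ and $H^i$, $s$ has exactly one child $t$, and conversely every child arises in this way; the edge from $s$ to $t$ is labeled $\sigma$ and $t$ is labeled with the concatenation $l_1::\dots::l_k$, where $l_i=[B^i_1\tau_i,\dots,B^i_{j_i}\tau_i]$. (In particular, for the empty list, every $\sigma:m\to z$ gives a child labeled with the empty list.) A refutation subtree of a saturated $\vee$-tree is a finite sequence of nodes $s_1,\dots,s_r$ where $s_1$ is the root, $s_{i+1}$ is a child of $s_i$, and $s_r$ is labeled with the empty list. Its answer is $\theta_{r-1}\circ\dots\circ\theta_2\circ\theta_1$, where $\theta_i$ labels the edge between $s_i$ and $s_{i+1}$ (the identity if $r=1$). SLD-resolution: starting from the goal $G_0=G$ (a finite collection of atoms over $x_1,\dots,x_n$), at step $i$ one selects an atom $A_i$ in the current goal $G_i$ and a clause $H\leftarrow B_1,\dots,B_j$ whose head unifies with $A_i$, with most general unifier $\langle\sigma_i,\tau_i\rangle$; the next goal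 $G_{i+1}$ consists of $B_1\tau_i,\dots,B_j\tau_i$ together with the atoms of $G_i$ other than $A_i$, instantiated by $\sigma_i$. An SLD-refutation is such a computation reaching the empty goal in finitely many steps; its computed answer is the composite of the $\sigma_i$'s (first $\sigma_0$, then $\sigma_1$, and so on). A correct answer is a substitution of the form $\sigma\circ\tau$ with $\tau$ a computed answer and $\sigma$ a substitution. *)

(* Defs.v *)
From mathcomp Require Import all_boot.
From Stdlib Require List.

Set Implicit Arguments.
Unset Strict Implicit.
Unset Printing Implicit Defensive.

(* Used both for the function symbols and for the predicate
   symbols. *)
Record signature := Signature { symbol : Type; arity : symbol -> nat }.

(* Terms with variables among x_1, ..., x_n; the variable x_(i+1) is
   [Var i] with [i : 'I_n]. *)
Inductive term (Sigma : signature) (n : nat) : Type :=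
| Var (i : 'I_n)
| App (f : symbol Sigma) (ts : {ffun 'I_(arity f) -> term Sigma n}).
Arguments Var {Sigma n} i.

Section Substitutions.
Context {Sigma : signature}.

(* The hom-set n -> m of the opposite Lawvere theory of Sigma. *)
Definition arrow (n m : nat) : Type := {ffun 'I_n -> term Sigma m}.

Fixpoint tsubst n m (theta : arrow n m) (t : term Sigma n) : term Sigma m :=
  match t with
  | Var i => theta i
  | App f ts => App [ffun k => tsubst theta (ts k)]
  end.

Definition idarr n : arrow n n := [ffun i => Var i].

Definition acomp n m p (sigma : arrow m p) (theta : arrow n m) : arrow n p :=
  [ffun i => tsubst sigma (theta i)].

Fixpoint tocc n (i : 'I_n) (t : term Sigma n) : bool :=
  match t with
  | Var j => i == j
  | App f ts => [exists k, tocc i (ts k)]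
  end.

Definition is_pushout r n n' m (a : arrow r n) (b : arrow r n')
    (sigma : arrow n m) (tau : arrow n' m) : Prop :=
  acomp sigma a = acomp tau b /\
  forall m' (sigma' : arrow n m') (tau' : arrow n' m'),
    acomp sigma' a = acomp tau' b ->
    exists! u : arrow m m', acomp u sigma = sigma' /\ acomp u tau = tau'.

End Substitutions.

Arguments arrow : clear implicits.

Record atom (Sigma Pi : signature) (n : nat) : Type := Atom {
  pred_of : symbol Pi;
  args_of : arrow Sigma (arity pred_of) n }.

Section Programs.
Context {Sigma Pi : signature}.

Definition goal (n : nat) : Type := seq (atom Sigma Pi n).

Definition asubst n m (theta : arrow Sigma n m) (A : atom Sigma Pi n) :
    atom Sigma Pi m :=
  Atom (acomp theta (args_of A)).

Definition aocc n (i : 'I_n) (A : atom Sigma Pi n) : bool :=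
  [exists k, tocc i (args_of A k)].

(* [clause_least] says that no m < nvars bounds the variables of the clause,
   i.e. that nvars is the number n_C. *)
Record clause : Type := Clause {
  nvars : nat;
  chead : atom Sigma Pi nvars;
  cbody : goal nvars;
  clause_least : [forall m : 'I_nvars, exists i : 'I_nvars,
                    (m <= i) && has (aocc i) (chead :: cbody)] }.

(* A finite set of clauses, presented by an enumeration: only membership [List.In]
   is used below, so order and repetitions are irrelevant. *)
Definition program : Type := seq clause.

Definition is_unifier n n' m (A : atom Sigma Pi n) (H : atom Sigma Pi n')
    (sigma : arrow Sigma n m) (tau : arrow Sigma n' m) : Prop :=
  asubst sigma A = asubst tau H.

(* The shared name [p] is the common predicate of the two atoms. *)
Definition is_mgu n n' m (A : atom Sigma Pi n) (H : atom Sigma Pi n')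
    (sigma : arrow Sigma n m) (tau : arrow Sigma n' m) : Prop :=
  exists (p : symbol Pi) (a : arrow Sigma (arity p) n)
         (h : arrow Sigma (arity p) n'),
    [/\ A = Atom a, H = Atom h & is_pushout a h sigma tau].

(* Possibly infinite trees whose root is labelled by a goal in n variables.
   The children of the root are indexed by [branch]; the edge to the child [b]
   is labelled by [edge b], and the child is the root of [child b]. *)
CoInductive vtree (n : nat) : Type :=
  VNode (l : goal n) (B : Type) (z : B -> nat)
        (e : forall b, arrow Sigma n (z b)) (c : forall b, vtree (z b)).

Definition label n (t : vtree n) : goal n := let: VNode l _ _ _ _ := t in l.
Definition branch n (t : vtree n) : Type := let: VNode _ B _ _ _ := t in B.
Definition target n (t : vtree n) : branch t -> nat :=
  let: VNode _ _ z _ _ := t in z.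
Definition edge n (t : vtree n) : forall b : branch t, arrow Sigma n (target b) :=
  let: VNode _ _ _ e _ := t in e.
Definition child n (t : vtree n) : forall b : branch t, vtree (target b) :=
  let: VNode _ _ _ _ c := t in c.

(* A clause C together with a substitution tau : n_C -> z. *)
Record clause_inst (z : nat) : Type := ClauseInst {
  ci_clause : clause;
  ci_subst : arrow Sigma (nvars ci_clause) z }.

Definition inst_body z (c : clause_inst z) : goal z :=
  [seq asubst (ci_subst c) B | B <- cbody (ci_clause c)].

(* The data sigma, [C_1, ..., C_k], tau_1, ..., tau_k determining one child of
   a node labelled [A_1, ..., A_k]; [List.Forall2] forces the two lists to have the
   same length k. *)
Record parallel_step (P : program) n (l : goal n) : Type := ParallelStep {
  ps_target : nat;
  ps_subst : arrow Sigma n ps_target;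
  ps_insts : seq (clause_inst ps_target);
  ps_unif : List.Forall2
    (fun A c => List.In (ci_clause c) P /\
                is_unifier A (chead (ci_clause c)) ps_subst (ci_subst c))
    l ps_insts }.

Definition ps_next P n (l : goal n) (s : parallel_step P l) :
    goal (ps_target s) :=
  flatten [seq inst_body c | c <- ps_insts s].

CoFixpoint saturated_tree (P : program) n (l : goal n) : vtree n :=
  VNode l (fun s : parallel_step P l => ps_subst s)
          (fun s : parallel_step P l => saturated_tree P (ps_next s)).

(* [refutation_subtree t m]: finite sequences of nodes s_1, ..., s_r from the
   root of t, each a child of the previous one, where s_r has the empty label
   in m variables. *)
Inductive refutation_subtree n (t : vtree n) : nat -> Type :=
| RefutLast of label t = [::] : refutation_subtree t n
| RefutDown m (b : branch t) of refutation_subtree (child b) m :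
    refutation_subtree t m.

Fixpoint subtree_answer n (t : vtree n) m (R : refutation_subtree t m) :
    arrow Sigma n m :=
  match R with
  | RefutLast _ => idarr n
  | RefutDown _ b R' => acomp (subtree_answer R') (edge b)
  end.

(* Goals are finite collections of atom occurrences; the order in the list
   plays no role since any position may be selected. *)
Record sld_step (P : program) n (G : goal n) : Type := SldStep {
  sld_before : goal n;
  sld_selected : atom Sigma Pi n;
  sld_after : goal n;
  sld_goalE : G = sld_before ++ sld_selected :: sld_after;
  sld_clause : clause;
  sld_clauseP : List.In sld_clause P;
  sld_target : nat;
  sld_subst : arrow Sigma n sld_target;
  sld_inst : arrow Sigma (nvars sld_clause) sld_target;
  sld_mgu : is_mgu sld_selected (chead sld_clause) sld_subst sld_inst }.

Definition sld_next P n (G : goal n) (s : sld_step P G) : goal (sld_target s) :=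
  [seq asubst (sld_inst s) B | B <- cbody (sld_clause s)] ++
  [seq asubst (sld_subst s) A | A <- sld_before s ++ sld_after s].

(* [sld_refutation P G m]: SLD-refutations of G whose final, empty goal is in m
   variables. *)
Inductive sld_refutation (P : program) n (G : goal n) : nat -> Type :=
| SldDone of G = [::] : sld_refutation P G n
| SldResolve m (s : sld_step P G) of sld_refutation P (sld_next s) m :
    sld_refutation P G m.

Fixpoint computed_answer P n (G : goal n) m (D : sld_refutation P G m) :
    arrow Sigma n m :=
  match D with
  | SldDone _ => idarr n
  | SldResolve _ s D' => acomp (computed_answer D') (sld_subst s)
  end.

Definition correct_answer P n (G : goal n) k (D : sld_refutation P G k)
    m (theta : arrow Sigma n m) : Prop :=
  exists sigma : arrow Sigma k m, theta = acomp sigma (computed_answer D).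

End Programs.

Arguments goal : clear implicits.
Arguments clause : clear implicits.
Arguments program : clear implicits.

(* Main.v *)
Require Import Defs.
From mathcomp Require Import all_boot.
From Stdlib Require List.

(** Both conditions are equivalent to: every atom of [G theta] is provable, i.e.
    has a finite proof tree built from instances of clauses of [P]. Proof trees
    are read off both kinds of computation directly. Conversely, the proof trees
    of all atoms of a goal can be traversed level by level, which gives a
    refutation subtree whose first edge is [theta] and whose other edges are
    identities; or one node at a time, lifting each clause instance to a most
    general unifier, which gives an SLD-refutation. The lifting needs that a pair
    of arrows completed to some commuting square has a pushout: this is
    first-order unification, by elimination of variables. *)

Set Implicit Arguments.
Unset Strict Implicit.
Unset Printing Implicit Defensive.

Lemma cons_inj T (x y : T) s t : x :: s = y :: t -> x = y /\ s = t.
Proof. by case. Qed.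

(** * Terms and the category of substitutions *)

Section Terms.
Context {Sigma : signature}.

(** Arguments of [App] sit inside a finite function, so the induction hypothesis for each argument
    has to be supplied by an explicit fixpoint. *)
Lemma term_nested_ind n (Q : term Sigma n -> Prop) :
  (forall i, Q (Var i)) ->
  (forall f (ts : {ffun 'I_(arity f) -> term Sigma n}),
     (forall k, Q (ts k)) -> Q (App ts)) ->
  forall t, Q t.
Proof.
move=> Qvar Qapp; fix IH 1 => -[i|f ts]; first exact: Qvar.
by apply: Qapp => k; apply: IH.
Qed.

Lemma tsubst_id n (t : term Sigma n) : tsubst (idarr n) t = t.
Proof.
elim/term_nested_ind: t => [i|f ts IH] /=; first by rewrite ffunE.
by congr App; apply/ffunP=> k; rewrite ffunE.
Qed.

Lemma tsubst_comp n m p (sigma : arrow Sigma m p) (theta : arrow Sigma n m) t :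
  tsubst (acomp sigma theta) t = tsubst sigma (tsubst theta t).
Proof.
elim/term_nested_ind: t => [i|f ts IH] /=; first by rewrite ffunE.
by congr App; apply/ffunP=> k; rewrite !ffunE.
Qed.

Lemma acompA n m p q (a : arrow Sigma p q) (b : arrow Sigma m p)
    (c : arrow Sigma n m) :
  acomp (acomp a b) c = acomp a (acomp b c).
Proof. by apply/ffunP=> i; rewrite !ffunE tsubst_comp. Qed.

Lemma acomp_idl n m (a : arrow Sigma n m) : acomp (idarr m) a = a.
Proof. by apply/ffunP=> i; rewrite ffunE tsubst_id. Qed.

Lemma acomp_idr n m (a : arrow Sigma n m) : acomp a (idarr n) = a.
Proof. by apply/ffunP=> i; rewrite !ffunE. Qed.

(** * Term size and the occurs check *)

Fixpoint tsize n (t : term Sigma n) : nat :=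
  match t with
  | Var _ => 1
  | App f ts => (\sum_k tsize (ts k)).+1
  end.

Lemma tsize_subst_occ n m (theta : arrow Sigma n m) i t :
  tocc i t -> tsize (theta i) <= tsize (tsubst theta t).
Proof.
elim/term_nested_ind: t => [j /eqP<- //|f ts IH /existsP[k /IH le_k]].
apply: leq_trans le_k (ltnW _) => /=.
by rewrite ltnS (bigD1 k) //= ffunE leq_addr.
Qed.

(** Under [theta], an argument containing [i] is at least as large as [theta i], and the enclosing
    [f] makes the whole strictly larger. *)
Lemma occurs_check n m (theta : arrow Sigma n m) i f
    (ts : {ffun 'I_(arity f) -> term Sigma n}) :
  tocc i (App ts) -> theta i <> tsubst theta (App ts).
Proof.
case/existsP=> k /tsize_subst_occ-/(_ _ theta) le_k eq_i.
move: le_k; rewrite eq_i leqNgt /= => /negP; apply.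
by rewrite ltnS (bigD1 k) //= ffunE leq_addr.
Qed.

(* The transport is along an existentially quantified equation, so that it can be
   destructed without uniqueness of identity proofs on symbols. *)
Lemma App_inj n f g (ts : {ffun 'I_(arity f) -> term Sigma n})
    (us : {ffun 'I_(arity g) -> term Sigma n}) :
  App ts = App us ->
  exists e : f = g,
    eq_rect f (fun h => {ffun 'I_(arity h) -> term Sigma n}) ts g e = us.
Proof.
move=> E.
pose Q (t : term Sigma n) := if t is App h vs then
  exists e : f = h,
    eq_rect f (fun h => {ffun 'I_(arity h) -> term Sigma n}) ts h e = vs
  else True.
by change (Q (App us)); rewrite -E; exists erefl.
Qed.

(** * Elimination of a variable *)

Definition weaken n (i : 'I_n.+1) : arrow Sigma n n.+1 :=
  [ffun k => Var (lift i k)].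

Lemma strengthen n (i : 'I_n.+1) (t : term Sigma n.+1) :
  ~~ tocc i t -> exists t', tsubst (weaken i) t' = t.
Proof.
elim/term_nested_ind: t => [j|f ts IH] /=.
  case/unlift_some=> k -> _; exists (Var k); by rewrite /= ffunE.
rewrite negb_exists => /forallP nocc.
have [us usE] := fin_all_exists (fun k => IH k (nocc k)).
exists (App (finfun us)) => /=; congr App; apply/ffunP=> k.
by rewrite !ffunE.
Qed.

Definition elim_var n (i : 'I_n.+1) (t : term Sigma n) : arrow Sigma n.+1 n :=
  [ffun j => if unlift i j is Some k then Var k else t].

Lemma elim_varK n (i : 'I_n.+1) t : acomp (elim_var i t) (weaken i) = idarr n.
Proof. by apply/ffunP=> k; rewrite !ffunE /= ffunE liftK. Qed.

(** A solution of the equation between [Var i] and the weakened [t] is determined by its values on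
    the other variables. *)
Lemma elim_var_factor n m (i : 'I_n.+1) t (theta : arrow Sigma n.+1 m) :
  theta i = tsubst theta (tsubst (weaken i) t) ->
  acomp (acomp theta (weaken i)) (elim_var i t) = theta.
Proof.
move=> eq_i; apply/ffunP=> j; rewrite !ffunE.
case: unliftP => [k|] -> /=; first by rewrite !ffunE.
by rewrite tsubst_comp.
Qed.

(** * Systems of equations and their most general unifiers *)

Fixpoint unifies n m (theta : arrow Sigma n m)
    (E : seq (term Sigma n * term Sigma n)) : Prop :=
  if E is e :: E' then tsubst theta e.1 = tsubst theta e.2 /\ unifies theta E'
  else True.

Lemma unifies_cat n m (theta : arrow Sigma n m) E1 E2 :
  unifies theta (E1 ++ E2) <-> unifies theta E1 /\ unifies theta E2.
Proof. by elim: E1 => [|e E IH] /=; tauto. Qed.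

Lemma unifies_map n m (theta : arrow Sigma n m) (I : eqType) (s : seq I) F :
  unifies theta [seq F k | k <- s] <->
  {in s, forall k, tsubst theta (F k).1 = tsubst theta (F k).2}.
Proof.
elim: s => [|k s IH] //=; split.
  by case=> Fk /IH Fs j; rewrite inE => /predU1P[->|/Fs].
move=> Fs; split; first by apply: Fs; rewrite mem_head.
by apply/IH => j js; apply: Fs; rewrite inE js orbT.
Qed.

Definition subst_eqs n m (theta : arrow Sigma n m) :=
  map (fun e : term Sigma n * term Sigma n =>
         (tsubst theta e.1, tsubst theta e.2)).

Lemma unifies_comp n m p (sigma : arrow Sigma m p) (theta : arrow Sigma n m) E :
  unifies (acomp sigma theta) E <-> unifies sigma (subst_eqs theta E).
Proof. by elim: E => [|e E IH] //=; rewrite !tsubst_comp; tauto. Qed.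

(** This is a coequalizer of the two arrows formed by the left-hand and the right-hand sides of
    [E]. *)
Definition most_general n (E : seq (term Sigma n * term Sigma n)) m
    (sigma : arrow Sigma n m) : Prop :=
  unifies sigma E /\
  forall m' (theta : arrow Sigma n m'), unifies theta E ->
    exists! u, acomp u sigma = theta.

Definition unifiable n (E : seq (term Sigma n * term Sigma n)) : Prop :=
  exists m (theta : arrow Sigma n m), unifies theta E.

Definition has_mgu n (E : seq (term Sigma n * term Sigma n)) : Prop :=
  exists m (sigma : arrow Sigma n m), most_general E sigma.

Lemma has_mgu_equiv n (E E' : seq (term Sigma n * term Sigma n)) :
  (forall m (theta : arrow Sigma n m), unifies theta E <-> unifies theta E') ->
  (unifiable E -> has_mgu E) -> unifiable E' -> has_mgu E'.
Proof.
move=> eqE IH [m0 [theta0 /eqE th0E]].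
have [|m [sigma [sE gen]]] := IH; first by exists m0, theta0.
by exists m, sigma; split=> [|m' theta /eqE/gen//]; apply/eqE.
Qed.

(** Restricting to the variables other than [i] turns solutions into solutions of the remaining
    equations in one variable fewer; a most general one of these is then composed with the
    elimination [s1]. *)
Lemma has_mgu_elim n i (t : term Sigma n) E :
  (forall n', n' < n -> forall E' : seq (term Sigma n' * term Sigma n'),
     unifiable E' -> has_mgu E') ->
  ~~ tocc i t -> unifiable ((Var i, t) :: E) -> has_mgu ((Var i, t) :: E).
Proof.
case: n => [|n] in i t E *; first by case: i.
move=> /(_ n (leqnn _)) IH /strengthen[t' <-] {t} uE.
pose w := weaken i; pose s1 := elim_var i t'.
have restrict m (theta : arrow Sigma n.+1 m) :
    unifies theta ((Var i, tsubst w t') :: E) ->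
    acomp (acomp theta w) s1 = theta /\
    unifies (acomp theta w) (subst_eqs s1 E).
  case=> /= /elim_var_factor eq_theta thE; split=> //.
  by apply/(unifies_comp _ s1); rewrite eq_theta.
have [|m [s2 [s2E gen]]] := IH (subst_eqs s1 E).
  by have [m [theta /restrict[_ thE]]] := uE; exists m, (acomp theta w).
exists m, (acomp s2 s1); split.
  split=> /=; last exact/unifies_comp.
  (* Both sides reduce to [tsubst s2 t']: [s1] sends [i] to [t'] and cancels [w]. *)
  rewrite ffunE tsubst_comp -(tsubst_comp s1) elim_varK tsubst_id.
  by rewrite ffunE unlift_none.
move=> m' theta /restrict[eq_theta /gen[u [u_th uniq_u]]].
exists u; split=> [|v v_th]; first by rewrite -acompA u_th.
(* Precomposing with [w] cancels [s1], so [v] also factors the restricted solution through [s2]. *)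
by apply: uniq_u; rewrite -v_th !acompA elim_varK acomp_idr.
Qed.

Lemma unifies_App n m (theta : arrow Sigma n m) f
    (ts us : {ffun 'I_(arity f) -> term Sigma n}) E :
  unifies theta ([seq (ts k, us k) | k <- enum 'I_(arity f)] ++ E) <->
  unifies theta ((App ts, App us) :: E).
Proof.
split=> [/unifies_cat[/unifies_map eq_args thE] | [/= eq_App thE]].
  split=> //=; congr App; apply/ffunP=> k; rewrite !ffunE.
  by apply: (eq_args k); rewrite mem_enum.
apply/unifies_cat; split=> //; apply/unifies_map => k _ /=.
(* Indexing arguments by plain numbers makes the projection independent of the head symbol, so no
   transport arises. *)
pose arg (t : term Sigma m) (k : nat) : option (term Sigma m) :=
  if t is App g vs then omap vs (insub k) else None.
have := congr1 (arg^~ k) eq_App.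
by rewrite /= valK /= !ffunE => -[].
Qed.

(** Lexicographic induction on the number of variables, then on the total size of the left-hand
    sides: elimination lowers the first; deleting a trivial equation or decomposing an application
    lowers the second. Clashes and occurs-check failures contradict unifiability. *)
Lemma unifiable_has_mgu n (E : seq (term Sigma n * term Sigma n)) :
  unifiable E -> has_mgu E.
Proof.
elim/ltn_ind: n => n IHn in E *.
have [b] := ubnP (\sum_(e <- E) tsize e.1); elim: b E => // b IHb.
case=> [|[s t] E] lt_b uE.
  exists n, (idarr n); split=> // m theta _.
  by exists theta; split=> [|v]; rewrite acomp_idr.
have elim_occ i f (ts : {ffun 'I_(arity f) -> term Sigma n}) :
    unifiable ((Var i, App ts) :: E) -> has_mgu ((Var i, App ts) :: E).
  move=> uE'; apply: has_mgu_elim => //; apply/negP=> occ.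
  by have [m [theta [/(occurs_check occ)]]] := uE'.
case: s t => [i|f ts] [j|g us] in lt_b uE *.
- case: (eqVneq i j) lt_b uE => [<-|neq_ij] lt_b uE; last exact: has_mgu_elim.
  apply: has_mgu_equiv (IHb E _) uE; last by move: lt_b; rewrite big_cons.
  by move=> m theta /=; tauto.
- exact: elim_occ.
(* The swapped equation is eliminated at once, so its larger left-hand side never meets the size
   bound. *)
- by apply: has_mgu_equiv (elim_occ j f ts) uE => m theta; split=> -[].
- have [e] : exists e : f = g, True.
    by have [m [theta [/App_inj[e _] _]]] := uE; exists e.
  case: g / e in us lt_b uE *; move=> _.
  apply: has_mgu_equiv (IHb _ _) uE => [m theta|]; first exact: unifies_App.
  by move: lt_b; rewrite big_cons big_cat big_map /= big_enum.
Qed.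

(** * Coproducts and pushouts of substitutions *)

Definition inl_arrow n n' : arrow Sigma n (n + n') :=
  [ffun i => Var (lshift n' i)].

Definition inr_arrow n n' : arrow Sigma n' (n + n') :=
  [ffun i => Var (rshift n i)].

Definition copair n n' m (sigma : arrow Sigma n m) (tau : arrow Sigma n' m) :
    arrow Sigma (n + n') m :=
  [ffun j => match split j with inl i => sigma i | inr i => tau i end].

Lemma copair_inl n n' m (sigma : arrow Sigma n m) (tau : arrow Sigma n' m) :
  acomp (copair sigma tau) (inl_arrow n n') = sigma.
Proof. by apply/ffunP=> i; rewrite !ffunE /= ffunE (unsplitK (inl i)). Qed.

Lemma copair_inr n n' m (sigma : arrow Sigma n m) (tau : arrow Sigma n' m) :
  acomp (copair sigma tau) (inr_arrow n n') = tau.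
Proof. by apply/ffunP=> i; rewrite !ffunE /= ffunE (unsplitK (inr i)). Qed.

Lemma copair_eta n n' m (rho : arrow Sigma (n + n') m) :
  copair (acomp rho (inl_arrow n n')) (acomp rho (inr_arrow n n')) = rho.
Proof.
apply/ffunP=> j; rewrite ffunE -{2}(splitK j).
by case: (split j) => i; rewrite !ffunE.
Qed.

(** A pushout is a coequalizer out of the coproduct: the variables are made disjoint in [n + n'],
    and the resulting equations are solved there, the given square showing that they are
    unifiable. *)
Lemma pushout_exists r n n' m (a : arrow Sigma r n) (b : arrow Sigma r n')
    (theta : arrow Sigma n m) (tau : arrow Sigma n' m) :
  acomp theta a = acomp tau b ->
  exists m0 (sigma0 : arrow Sigma n m0) (tau0 : arrow Sigma n' m0),
    is_pushout a b sigma0 tau0.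
Proof.
move=> eq_ab; pose il := inl_arrow n n'; pose ir := inr_arrow n n'.
pose E := [seq (tsubst il (a k), tsubst ir (b k)) | k <- enum 'I_r].
have unifE p (rho : arrow Sigma (n + n') p) :
    unifies rho E <-> acomp (acomp rho il) a = acomp (acomp rho ir) b.
  rewrite unifies_map; split=> [eq_k | /ffunP eq_k k _] /=.
    by apply/ffunP=> k; rewrite !ffunE !tsubst_comp eq_k ?mem_enum.
  by rewrite -!tsubst_comp; have := eq_k k; rewrite !ffunE.
have [|m0 [rho [/unifE rhoE gen]]] := @unifiable_has_mgu _ E.
  by exists m, (copair theta tau); apply/unifE; rewrite copair_inl copair_inr.
exists m0, (acomp rho il), (acomp rho ir); split=> // m' sigma' tau' eq_ab'.
have [|u [u_rho uniq_u]] := gen m' (copair sigma' tau').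
  by apply/unifE; rewrite copair_inl copair_inr.
exists u; split=> [|v [v_l v_r]].
  by rewrite -!acompA u_rho copair_inl copair_inr.
by apply: uniq_u; rewrite -v_l -v_r -!acompA copair_eta.
Qed.

End Terms.

Section Programs.
Context {Sigma Pi : signature}.
Implicit Type P : program Sigma Pi.

(** * Atoms and their unifiers *)

Lemma asubst_id n (A : atom Sigma Pi n) : asubst (idarr n) A = A.
Proof. by case: A => p a; rewrite /asubst acomp_idl. Qed.

Lemma asubst_comp n m p (sigma : arrow Sigma m p) (theta : arrow Sigma n m)
    (A : atom Sigma Pi n) :
  asubst (acomp sigma theta) A = asubst sigma (asubst theta A).
Proof. by rewrite /asubst acompA. Qed.

Lemma Atom_inj n (p q : symbol Pi) (a : arrow Sigma (arity p) n)
    (b : arrow Sigma (arity q) n) :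
  Atom a = Atom b ->
  exists e : p = q, eq_rect p (fun s => arrow Sigma (arity s) n) a q e = b.
Proof.
move=> E.
pose Q (A : atom Sigma Pi n) :=
  let: Atom s c := A in
  exists e : p = s, eq_rect p (fun s => arrow Sigma (arity s) n) a s e = c.
by change (Q (Atom b)); rewrite -E; exists erefl.
Qed.

Lemma unifier_factors_mgu n n' m (A : atom Sigma Pi n) (H : atom Sigma Pi n')
    (theta : arrow Sigma n m) (tau : arrow Sigma n' m) :
  is_unifier A H theta tau ->
  exists m0 (sigma0 : arrow Sigma n m0) (tau0 : arrow Sigma n' m0)
      (u : arrow Sigma m0 m),
    [/\ is_mgu A H sigma0 tau0, acomp u sigma0 = theta & acomp u tau0 = tau].
Proof.
case: A H => [p a] [q h] /Atom_inj[/= e].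
case: q / e h => h /= eq_ah.
have [m0 [sigma0 [tau0 po]]] := pushout_exists eq_ah.
have [u [[u_sigma u_tau] _]] := po.2 _ _ _ eq_ah.
by exists m0, sigma0, tau0, u; split=> //; exists p, a, h.
Qed.

Lemma mgu_unifier n n' m (A : atom Sigma Pi n) (H : atom Sigma Pi n')
    (sigma : arrow Sigma n m) (tau : arrow Sigma n' m) :
  is_mgu A H sigma tau -> is_unifier A H sigma tau.
Proof.
by case=> p [a [h [-> -> [eq_ah _]]]]; rewrite /is_unifier /asubst /= eq_ah.
Qed.

(** * Proof trees *)

Inductive provable P m (A : atom Sigma Pi m) : Prop :=
  Provable (C : clause Sigma Pi) (tau : arrow Sigma (nvars C) m) of
    List.In C P & A = asubst tau (chead C) &
    (forall B, List.In B (cbody C) -> provable P (asubst tau B)).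

Definition all_provable P n m (theta : arrow Sigma n m) (G : goal Sigma Pi n) :=
  forall A, List.In A G -> provable P (asubst theta A).

(** The step hypothesis says that prefixing the body preserves [Q] for every [l], not only for the
    current one: a parallel step also rewrites the rest of the goal, so the body must be prefixed to
    a different list. *)
Lemma provable_goal_ind P m (Q : goal Sigma Pi m -> Prop) :
  Q [::] ->
  (forall C (tau : arrow Sigma (nvars C) m), List.In C P ->
     (forall l, Q l -> Q ([seq asubst tau B | B <- cbody C] ++ l)) ->
     forall l, Q l -> Q (asubst tau (chead C) :: l)) ->
  forall n (theta : arrow Sigma n m) G, all_provable P theta G ->
    Q [seq asubst theta A | A <- G].
Proof.
move=> Q0 Qstep.
have Qcons A : provable P A -> forall l, Q l -> Q (A :: l).
  elim=> {}A C tau CP -> _ IH; apply: Qstep => // l Ql.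
  elim: (cbody C) IH => [|B bs IHbs] //= IH.
  by apply: (IH B); [left | apply: IHbs => B' B'bs; apply: IH; right].
move=> n theta; elim=> [|A G IHG] //= prG; apply: Qcons.
  by apply: prG; left.
by apply: IHG => B BG; apply: prG; right.
Qed.

(** * Soundness of both kinds of refutation *)

Lemma saturated_sound P n (t : vtree n) m (R : refutation_subtree t m) G :
  t = saturated_tree P G -> all_provable P (subtree_answer R) G.
Proof.
(* [R] lives over an arbitrary tree, so the equation with the saturated tree travels through the
   induction. *)
elim: R G => {n t m} [n t lab|n t m b R IH] G eq_t.
  by move: lab; rewrite eq_t /= => ->.
subst t; case: b R IH => [z sigma insts unif] R /(_ _ erefl) /=.
rewrite /ps_next /=; move: (subtree_answer R : arrow Sigma z m) => rho {R}.
elim: unif => [_ B []|A c l cs [CP AH] _ IHl prB B [<-|Bl]]; last first.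
  by apply: IHl Bl => B' B'cs; apply: prB; apply/List.in_or_app; right.
(* After [sigma] the atom is an instance of the head; [rho] keeps it one, and the body instance is
   part of the child's label. *)
exists (ci_clause c) (acomp rho (ci_subst c)) => // [|B' B'C].
  by rewrite !asubst_comp AH.
rewrite asubst_comp; apply: prB; apply/List.in_or_app; left.
exact: List.in_map.
Qed.

Lemma sld_sound P n (G : goal Sigma Pi n) k (D : sld_refutation P G k)
    m (sigma : arrow Sigma k m) :
  all_provable P (acomp sigma (computed_answer D)) G.
Proof.
elim: D m sigma => {n G k} [n G eqG|n G k s D IH] m sigma /=.
  by rewrite eqG => A [].
case: s D IH => [l1 A0 l2 eqG C CP z rho tau mgu] D /(_ m sigma).
rewrite /sld_next /= -acompA.
move: (acomp sigma _ : arrow Sigma z m) => theta {D k sigma} pr.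
have prA A : List.In A (l1 ++ l2) -> provable P (asubst (acomp theta rho) A).
  move=> Al; rewrite asubst_comp; apply: pr; apply/List.in_or_app; right.
  exact: List.in_map.
rewrite eqG => A /List.in_app_iff[Al|[<-|Al]].
- by apply: prA; apply/List.in_or_app; left.
- exists C (acomp theta tau) => // [|B BC].
    by rewrite !asubst_comp (mgu_unifier mgu).
  rewrite asubst_comp; apply: pr; apply/List.in_or_app; left.
  exact: List.in_map.
- by apply: prA; apply/List.in_or_app; right.
Qed.

(** * Completeness of SLD-resolution *)

Lemma sld_complete P n m (theta : arrow Sigma n m) (G : goal Sigma Pi n) :
  all_provable P theta G ->
  exists k (D : sld_refutation P G k), correct_answer D theta.
Proof.
(* All goals with instance [l] are covered, because a step with a most general unifier changes the
   goal, its variables and the remaining substitution. *)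
pose Q (l : goal Sigma Pi m) :=
  forall n (theta : arrow Sigma n m) G, [seq asubst theta A | A <- G] = l ->
    exists k (D : sld_refutation P G k), correct_answer D theta.
move=> prG.
apply: (provable_goal_ind (Q := Q) _ _ prG) (erefl _) => {n theta G prG}.
  move=> n theta [|//] _; exists n, (SldDone P (erefl [::])), theta.
  by rewrite /= acomp_idr.
move=> C tau CP Qbody l /Qbody Qnext n theta [//|A G] /= eqG.
have [AH Gl] := cons_inj eqG.
have [z [rho [tau0 [u [mgu u_rho u_tau]]]]] :=
  unifier_factors_mgu (AH : is_unifier A (chead C) theta tau).
(* Selecting the first atom gives a next goal whose instance under [u] is the body followed by
   [l]. *)
pose s := SldStep (erefl ([::] ++ A :: G)) CP mgu.
have [|k [D [sigma sigmaD]]] := Qnext z u (sld_next s).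
  rewrite /sld_next /= map_cat -!map_comp -u_tau -Gl -u_rho.
  by congr cat; apply: eq_map => B /=; rewrite asubst_comp.
by exists k, (SldResolve (s := s) D), sigma; rewrite /= -acompA -sigmaD.
Qed.

(** * Completeness of the saturated tree *)

Inductive parallel_refutable P m : goal Sigma Pi m -> Prop :=
| ParallelNil : parallel_refutable P [::]
| ParallelResolve l (insts : seq (@clause_inst Sigma Pi m)) of
    List.Forall2 (fun A c => List.In (ci_clause c) P /\
      A = asubst (ci_subst c) (chead (ci_clause c))) l insts &
    parallel_refutable P (flatten [seq inst_body c | c <- insts]) :
    parallel_refutable P l.

Lemma provable_parallel P n m (theta : arrow Sigma n m) (G : goal Sigma Pi n) :
  all_provable P theta G ->
  parallel_refutable P [seq asubst theta A | A <- G].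
Proof.
apply: provable_goal_ind; first exact: ParallelNil.
(* The new atom is resolved alone if the rest is empty, and otherwise together with the first
   parallel step of the rest. *)
move=> C tau CP par_body _ [|l insts unif par_next].
  apply: (@ParallelResolve _ _ _ [:: ClauseInst tau]); first by constructor.
  exact: par_body (ParallelNil _ _).
apply: (@ParallelResolve _ _ _ (ClauseInst tau :: insts)); first by constructor.
exact: par_body par_next.
Qed.

Lemma parallel_saturated P n m (theta : arrow Sigma n m) G :
  parallel_refutable P [seq asubst theta A | A <- G] ->
  exists R : refutation_subtree (saturated_tree P G) m, subtree_answer R = theta.
Proof.
move eq_l: (map _ _) => l par_l.
elim: par_l n theta G eq_l => {l} [|l insts unif _ IH] n theta G.
  case: G => // _.
  (* One edge is needed even here: the empty sequence would answer [idarr n]. *)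
  pose s := @ParallelStep _ _ P n [::] m theta [::] (List.Forall2_nil _).
  pose last := @RefutLast _ _ m (saturated_tree P (ps_next s)) erefl.
  exists (@RefutDown _ _ n (saturated_tree P [::]) m s last).
  by rewrite /= acomp_idl.
move=> eq_l.
have {eq_l}unif : List.Forall2 (fun A c => List.In (ci_clause c) P /\
    is_unifier A (chead (ci_clause c)) theta (ci_subst c)) G insts.
  elim: unif G eq_l => [|A' c l' cs Ac _ IHl] [|A G] // eqG.
  have [AE Gl] := cons_inj eqG; rewrite -AE in Ac.
  by constructor; last exact: IHl.
pose s := ParallelStep unif.
(* The first edge carries [theta], so the child is already over [m] variables and the rest of the
   path has answer the identity. *)
have [|R R_id] := IH m (idarr m) (ps_next s).
  by rewrite (eq_map (@asubst_id m)) map_id.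
exists (@RefutDown _ _ n (saturated_tree P G) m s R).
by rewrite /= R_id acomp_idl.
Qed.

End Programs.

Theorem theorem10p10 (Sigma Pi : signature) (P : program Sigma Pi) (n : nat)
    (G : goal Sigma Pi n) (m : nat) (theta : arrow Sigma n m) :
  (exists R : refutation_subtree (saturated_tree P G) m,
      subtree_answer R = theta) <->
  (exists (k : nat) (D : sld_refutation P G k), correct_answer D theta).
Proof.
split=> [[R <-] | [k [D [sigma ->]]]].
  exact/sld_complete/saturated_sound.
exact/parallel_saturated/provable_parallel/sld_sound.
Qed.
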